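(* Let $(M,d)$ be a metric space with a distinguished point $0\in M$ and let $f\in \mathrm{Lip}_0(M,M)$. If $M$ is countable and asymptotically uniformly discrete (with respect to $0$), then the following assertions are equivalent: \begin{enumerate} \item $T_f$ is hypercyclic on $\mathcal F(M)$; \item $T_f$ is weakly mixing on $\mathcal F(M)$; \item $f$ has the targeting property around $0\in M$. \end{enumerate}
   Context: For a metric space $(M,d)$ with distinguished point $0$, $\mathrm{Lip}_0(M)$ is the real Banach space of Lipschitz functions $g\colon M\to\mathbb R$ with $g(0)=0$, normed by the Lipschitz constant. For $x\in M$, $\delta_x\in \mathrm{Lip}_0(M)^*$ is evaluation at $x$. The Lipschitz-free space is $\mathcal F(M)=\overline{\operatorname{span}}\{\delta_x:x\in M\}\subset \mathrm{Lip}_0(M)^*$ (dual norm closure). $\mathrm{Lip}_0(M,M)$ is the set of Lipschitz maps $f\colon M\to M$ with $f(0)=0$; for such $f$, $T_f\colon\mathcal F(M)\to\mathcal F(M)$ is the unique bounded linear operator with $T_f(\delta_x)=\delta_{f(x)}$ for all $x\in M$. $M$ is asymptotically uniformly discrete with respect to $x_0\in M$ if for every $\varepsilon>0$ there exists $r_\varepsilon>0$ such that for all $x\neq y$ in $M$, $d(x,y)<r_\varepsilon$ implies $x,y\in B(x_0,\varepsilon)$ (open ball). A continuous map $f\colon M\to M$ with $f(x_0)=x_0$ has the targeting property around $x_0$ if for every $\varepsilon>0$ and every finite $F\subset M$ there is $n\in\mathbb N$ ($n\ge1$) such that for every $x,y\in F$: (i) there exist $u,u_0\in M$ with $\max\{d(u,x),d(u_0,x_0),d(f^n(u),f^n(u_0))\}<\varepsilon$;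 and (ii) there exist $v,v_0\in M$ with $\max\{d(v,v_0),d(f^n(v),y),d(f^n(v_0),x_0)\}<\varepsilon$. An operator $T$ is hypercyclic if it has a dense orbit $\{T^n x:n\ge0\}$, and weakly mixing if $T\times T$ is topologically transitive. *)

(* Defs.v *)
From HB Require Import structures.
From mathcomp Require Import all_boot all_order all_algebra.
From mathcomp Require Import all_classical all_reals all_analysis.

Set Implicit Arguments.
Unset Strict Implicit.
Unset Printing Implicit Defensive.

Import Order.TTheory GRing.Theory Num.Theory.
Import numFieldNormedType.Exports.

Local Open Scope classical_set_scope.
Local Open Scope ring_scope.

Section Lipschitz.
Context {R : realType}.

Definition lipschitz_map (X Y : metricType R) (f : X -> Y) : Prop :=
  exists L : R, forall x y, mdist (f x) (f y) <= L * mdist x y.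

Definition asymptotically_uniformly_discrete (M : metricType R) (x0 : M)
    : Prop :=
  forall e : R, 0 < e -> exists2 r : R, 0 < r &
    forall x y : M, x != y -> mdist x y < r -> ball x0 e x /\ ball x0 e y.

Definition targeting_property (M : metricType R) (x0 : M) (f : M -> M)
    : Prop :=
  forall (e : R) (F : set M), 0 < e -> finite_set F ->
  exists2 n : nat, (1 <= n)%N & forall x y : M, F x -> F y ->
    (exists u u0 : M,
       Num.max (mdist u x)
         (Num.max (mdist u0 x0) (mdist (iter n f u) (iter n f u0))) < e) /\
    (exists v v0 : M,
       Num.max (mdist v v0)
         (Num.max (mdist (iter n f v) y) (mdist (iter n f v0) x0)) < e).

Lemma lipschitz_map_gt0 (X Y : metricType R) (f : X -> Y) :
  lipschitz_map f ->
  exists2 L : R, 0 < L & forall x y, mdist (f x) (f y) <= L * mdist x y.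
Proof.
move=> [L fL]; exists (`|L| + 1); first by rewrite ltr_wpDl.
move=> x y; rewrite (le_trans (fL x y))// ler_wpM2r ?mdist_ge0//.
by rewrite (le_trans (ler_norm L))// lerDl.
Qed.

End Lipschitz.

Section LinearDynamics.

Definition hypercyclic (V : topologicalType) (T : V -> V) : Prop :=
  exists x : V, dense (range (fun n : nat => iter n T x)).

Definition topologically_transitive (V : topologicalType) (T : V -> V)
    : Prop :=
  forall U W : set V, open U -> U !=set0 -> open W -> W !=set0 ->
    exists n : nat, (iter n T @` U) `&` W !=set0.

Definition weakly_mixing (V : topologicalType) (T : V -> V) : Prop :=
  topologically_transitive (fun p : V * V => (T p.1, T p.2)).

End LinearDynamics.

Section Lip0.
Context {R : realType} (M : metricType R) (o : M).

Definition lip0_pred : {pred M -> R^o} :=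
  mem [set g : M -> R^o | lipschitz_map g /\ g o = 0].

Record Lip0 := MkLip0 { lip0_fun :> M -> R^o ; _ : lip0_fun \in lip0_pred }.

HB.instance Definition _ := [isSub for lip0_fun].
HB.instance Definition _ := [Choice of Lip0 by <:].

Lemma lip0_submod : submod_closed lip0_pred.
Proof.
split=> [|a g h]; rewrite !inE.
  by split=> //; exists 0 => x y; rewrite mul0r /mdist/= subrr normr0.
move=> [/lipschitz_map_gt0[K K0 gK] g0] [/lipschitz_map_gt0[L L0 hL] h0].
split; last by rewrite !fctE g0 h0 scaler0 addr0.
exists (`|a| * K + L) => x y; rewrite mulrDl -mulrA.
apply: le_trans (lerD (ler_wpM2l (normr_ge0 a) (gK x y)) (hL x y)).
rewrite /mdist/= !fctE opprD addrACA -scalerBr.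
by rewrite (le_trans (ler_normD _ _))// normrM.
Qed.

HB.instance Definition _ :=
  GRing.isSubmodClosed.Build R _ lip0_pred lip0_submod.
HB.instance Definition _ := [SubChoice_isSubLmodule of Lip0 by <:].

Lemma lip0_lipschitz (g : Lip0) : lipschitz_map g.
Proof. by case: g => g /= /[!inE] -[]. Qed.

Lemma lip0_base (g : Lip0) : g o = 0.
Proof. by case: g => g /= /[!inE] -[]. Qed.

Lemma lip0D (g h : Lip0) x : (g + h) x = g x + h x.
Proof. by []. Qed.

Lemma lip0Z (a : R) (g : Lip0) x : (a *: g) x = a * g x.
Proof. by []. Qed.

Definition lip_slopes (g : M -> R^o) : set R :=
  [set `|g p.1 - g p.2| / mdist p.1 p.2 | p in [set p : M * M | p.1 != p.2]].

(** [sup set0 = 0], so the norm is [0] when [M] is a single point. *)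
Definition lip_norm (g : Lip0) : R := sup (lip_slopes g).

Lemma lip_slopes_bounded (g : Lip0) : has_ubound (lip_slopes g).
Proof.
have [L L0 gL] := lipschitz_map_gt0 (lip0_lipschitz g).
exists L => _ [[x y] /= xy <-]; rewrite ler_pdivrMr ?mdist_gt0//.
by have := gL x y; rewrite /mdist/= distrC.
Qed.

Lemma lip_norm_ge0 g : 0 <= lip_norm g.
Proof.
rewrite /lip_norm; have [->|/set0P[s sg]] := eqVneq (lip_slopes g) set0.
  by rewrite sup0.
apply: le_trans (ub_le_sup (lip_slopes_bounded g) sg).
by case: sg => p _ <-; rewrite divr_ge0// mdist_ge0.
Qed.

Lemma le_lip_norm (g : Lip0) x y : `|g x - g y| <= lip_norm g * mdist x y.
Proof.
have [->|xy] := eqVneq x y; first by rewrite subrr normr0 mdistxx mulr0.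
rewrite -ler_pdivrMr ?mdist_gt0//; apply: (ub_le_sup (lip_slopes_bounded g)).
by exists (x, y).
Qed.

Lemma lip_norm_le (g : Lip0) (L : R) : 0 <= L ->
  (forall x y, `|g x - g y| <= L * mdist x y) -> lip_norm g <= L.
Proof.
move=> L0 gL; rewrite /lip_norm.
have [->|/set0P s0] := eqVneq (lip_slopes g) set0; first by rewrite sup0.
by apply: ge_sup => // _ [[x y] /= xy <-]; rewrite ler_pdivrMr ?mdist_gt0.
Qed.

Lemma lip_normD g h : lip_norm (g + h) <= lip_norm g + lip_norm h.
Proof.
apply: lip_norm_le => [|x y]; first by rewrite addr_ge0// lip_norm_ge0.
rewrite mulrDl; apply: le_trans (lerD (le_lip_norm g x y) (le_lip_norm h x y)).
by rewrite !lip0D opprD addrACA ler_normD.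
Qed.

Lemma lip_normZ_le (a : R) g : lip_norm (a *: g) <= `|a| * lip_norm g.
Proof.
apply: lip_norm_le => [|x y]; first by rewrite mulr_ge0// lip_norm_ge0.
by rewrite !lip0Z -mulrBr normrM -mulrA ler_wpM2l// le_lip_norm.
Qed.

Lemma lip_normZ (a : R) g : lip_norm (a *: g) = `|a| * lip_norm g.
Proof.
apply/le_anti; rewrite lip_normZ_le/=.
have [->|a0] := eqVneq a 0; first by rewrite normr0 mul0r lip_norm_ge0.
rewrite -ler_pdivlMl ?normr_gt0// -normfV.
by apply: le_trans (lip_normZ_le _ _); rewrite scalerA mulVf// scale1r.
Qed.

Lemma lip_norm0_eq0 g : lip_norm g = 0 -> g = 0.
Proof.
move=> g0; apply/val_inj/funext => x /=; apply/eqP.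
have := le_lip_norm g x o.
by rewrite lip0_base subr0 g0 mul0r normr_le0.
Qed.

HB.instance Definition _ :=
  Lmodule_isNormed.Build R Lip0 lip_normD lip_normZ lip_norm0_eq0.

End Lip0.

Section Dual.
Context {R : realType} (V : normedModType R).

Definition dual_pred : {pred V -> R^o} :=
  mem [set phi : V -> R^o | linear phi /\ continuous phi].

Record dual_space :=
  MkDual { dual_fun :> V -> R^o ; _ : dual_fun \in dual_pred }.

HB.instance Definition _ := [isSub for dual_fun].
HB.instance Definition _ := [Choice of dual_space by <:].

Lemma dual_submod : submod_closed dual_pred.
Proof.
split=> [|a g h]; rewrite !inE.
  split=> [b u v|]; last exact: cst_continuous.
  by rewrite -[LHS]/(0 : R^o) -[RHS]/(b *: (0 : R^o) + 0) scaler0 addr0.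
move=> [gl gc] [hl hc]; split=> [b u v|].
  rewrite !fctE gl hl !scalerDr !scalerA (mulrC a b) -!addrA.
  by congr (_ + _); rewrite addrCA.
by move=> v; apply: cvgD (hc v); apply: cvgZr; exact: gc.
Qed.

HB.instance Definition _ :=
  GRing.isSubmodClosed.Build R _ dual_pred dual_submod.
HB.instance Definition _ := [SubChoice_isSubLmodule of dual_space by <:].

Lemma dual_linear (phi : dual_space) : linear phi.
Proof. by case: phi => phi /= /[!inE] -[]. Qed.

Lemma dual_continuous (phi : dual_space) : continuous phi.
Proof. by case: phi => phi /= /[!inE] -[]. Qed.

HB.instance Definition _ (phi : dual_space) :=
  GRing.isLinear.Build R V R^o *:%R phi (dual_linear phi).

Lemma dualD (phi psi : dual_space) v : (phi + psi) v = phi v + psi v.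
Proof. by []. Qed.

Lemma dualZ (a : R) (phi : dual_space) v : (a *: phi) v = a * phi v.
Proof. by []. Qed.

Definition dual_norm (phi : dual_space) : R :=
  sup [set `|phi v| | v in [set v : V | `|v| <= 1]].

Lemma linear_bounded_in_dual (phi : V -> R^o) (L : R) :
  linear phi -> (forall v, `|phi v| <= L * `|v|) -> phi \in dual_pred.
Proof.
move=> phil phiL; rewrite inE; split=> //.
pose p : {linear V -> R^o} := HB.pack phi (GRing.isLinear.Build _ _ _ _ _ phil).
apply: (@bounded_linear_continuous _ _ _ p); apply/linear_boundedP.
exists L; split=> [|r Lr v]; first exact: num_real.
by rewrite (le_trans (phiL v))// ler_wpM2r// ltW.
Qed.

Lemma dual_bounded (phi : dual_space) :
  has_ubound [set `|phi v| | v in [set v : V | `|v| <= 1]].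
Proof.
have /linear_bounded_continuous/linear_boundedP :=
  @dual_continuous phi.
move=> /pinfty_ex_gt0[r r0 phir]; exists r => _ [v /= v1 <-].
by rewrite (le_trans (phir v))// ger_pMr.
Qed.

Lemma dual_norm_ge0 phi : 0 <= dual_norm phi.
Proof.
apply: le_trans (ub_le_sup (dual_bounded phi) _); last first.
  by exists 0 => //=; rewrite normr0.
exact: normr_ge0.
Qed.

Lemma le_dual_norm (phi : dual_space) v : `|phi v| <= dual_norm phi * `|v|.
Proof.
have [->|v0] := eqVneq v 0; first by rewrite linear0 !normr0 mulr0.
rewrite -ler_pdivrMr ?normr_gt0//; apply: (ub_le_sup (dual_bounded phi)).
exists (`|v|^-1 *: v); rewrite /= ?linearZ normrZ normfV normr_id.
  by rewrite mulVf// normr_eq0.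
by rewrite mulrC.
Qed.

Lemma dual_norm_le (phi : dual_space) (L : R) : 0 <= L ->
  (forall v, `|phi v| <= L * `|v|) -> dual_norm phi <= L.
Proof.
move=> L0 phiL; apply: ge_sup; first by
  exists `|phi 0|, 0 => //=; rewrite normr0.
by move=> _ [v /= v1 <-]; rewrite (le_trans (phiL v))// ler_piMr.
Qed.

Lemma dual_normD phi psi :
  dual_norm (phi + psi) <= dual_norm phi + dual_norm psi.
Proof.
apply: dual_norm_le => [|v]; first by rewrite addr_ge0// dual_norm_ge0.
rewrite mulrDl.
apply: le_trans (lerD (le_dual_norm phi v) (le_dual_norm psi v)).
exact: ler_normD.
Qed.

Lemma dual_normZ_le (a : R) phi : dual_norm (a *: phi) <= `|a| * dual_norm phi.
Proof.
apply: dual_norm_le => [|v]; first by rewrite mulr_ge0// dual_norm_ge0.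
by rewrite dualZ normrM -mulrA ler_wpM2l// le_dual_norm.
Qed.

Lemma dual_normZ (a : R) phi : dual_norm (a *: phi) = `|a| * dual_norm phi.
Proof.
apply/le_anti; rewrite dual_normZ_le/=.
have [->|a0] := eqVneq a 0; first by rewrite normr0 mul0r dual_norm_ge0.
rewrite -ler_pdivlMl ?normr_gt0// -normfV.
by apply: le_trans (dual_normZ_le _ _); rewrite scalerA mulVf// scale1r.
Qed.

Lemma dual_norm0_eq0 phi : dual_norm phi = 0 -> phi = 0.
Proof.
move=> phi0; apply/val_inj/funext => v /=; apply/eqP.
by have := le_dual_norm phi v; rewrite phi0 mul0r normr_le0.
Qed.

HB.instance Definition _ :=
  Lmodule_isNormed.Build R dual_space dual_normD dual_normZ dual_norm0_eq0.

End Dual.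
Arguments dual_pred {R} V.

Section ClosedSpan.
Context {R : realType} (V : normedModType R).

Definition lin_span (A : set V) : set V :=
  [set v | exists (n : nat) (a : 'I_n -> R) (x : 'I_n -> V),
     (forall i, A (x i)) /\ v = \sum_(i < n) a i *: x i].

Lemma lin_span0 A : lin_span A 0.
Proof.
by exists 0%N, (fun=> 0), (fun=> 0); split=> [[]//|]; rewrite big_ord0.
Qed.

Lemma lin_span_sub A : A `<=` lin_span A.
Proof.
move=> v Av; exists 1%N, (fun=> 1), (fun=> v); split=> //.
by rewrite big_ord1 scale1r.
Qed.

Lemma lin_span_lin A (a : R) u v :
  lin_span A u -> lin_span A v -> lin_span A (a *: u + v).
Proof.
move=> [m [b [x [Ax ->]]]] [n [c [y [Ay ->]]]].
exists (m + n)%N,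
  (fun k => match fintype.split k with inl i => a * b i | inr j => c j end),
  (fun k => match fintype.split k with inl i => x i | inr j => y j end).
split=> [k|]; first by case: fintype.split.
rewrite big_split_ord/= scaler_sumr; congr (_ + _); apply: eq_bigr => i _.
  by rewrite (unsplitK (inl _ i)) scalerA.
by rewrite (unsplitK (inr _ i)).
Qed.

Lemma closure_normP (A : set V) v :
  closure A v <-> forall e : R, 0 < e -> exists2 w, A w & `|v - w| < e.
Proof.
split=> [Av e e0|Av B /nbhs_ballP[e /= e0 eB]].
  have [w [Aw]] := Av _ (nbhsx_ballx v e e0).
  by rewrite -ball_normE/= => vw; exists w.
have [w Aw vw] := Av _ e0; exists w; split=> //; apply: eB.
by rewrite -ball_normE.
Qed.

Lemma closed_span_submod A : submod_closed (mem (closure (lin_span A))).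
Proof.
split=> [|a u v]; rewrite !inE; first exact/subset_closure/lin_span0.
move=> /closure_normP Au /closure_normP Av; apply/closure_normP => e e0.
have a1 : 0 < `|a| + 1 by rewrite ltr_wpDl.
have [u' Au' uu'] := Au _ (divr_gt0 (divr_gt0 e0 (ltr0Sn _ 1)) a1).
have [v' Av' vv'] := Av _ (divr_gt0 e0 (ltr0Sn _ 1)).
exists (a *: u' + v'); first exact: lin_span_lin.
rewrite opprD addrACA -scalerBr (splitr e).
apply: le_lt_trans (ler_normD _ _) _; apply: ler_ltD => //.
rewrite normrZ; move: uu'; rewrite ltr_pdivlMr// => /ltW; apply: le_trans.
by rewrite mulrC ler_wpM2l// lerDl.
Qed.

End ClosedSpan.

Section FreeSpace.
Context {R : realType} (M : metricType R) (o : M).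

Definition evaluation_fun (x : M) : Lip0 o -> R^o := fun g => g x.

Lemma evaluation_in_dual x : evaluation_fun x \in dual_pred (Lip0 o).
Proof.
apply: (@linear_bounded_in_dual _ _ _ (mdist x o)) => // g.
by have := le_lip_norm g x o; rewrite lip0_base subr0 mulrC.
Qed.

Definition evaluation (x : M) : dual_space (Lip0 o) :=
  MkDual (evaluation_in_dual x).

Definition free_pred : {pred dual_space (Lip0 o)} :=
  mem (closure (lin_span (range evaluation))).

Record lipschitz_free := MkFree {
  free_val :> dual_space (Lip0 o) ; _ : free_val \in free_pred }.

HB.instance Definition _ := [isSub for free_val].
HB.instance Definition _ := [Choice of lipschitz_free by <:].
HB.instance Definition _ := GRing.isSubmodClosed.Build R _ free_pred
  (closed_span_submod (range evaluation)).
HB.instance Definition _ := [SubChoice_isSubLmodule of lipschitz_free by <:].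

Definition free_norm (m : lipschitz_free) : R := `|free_val m|.

Lemma free_normD m n : free_norm (m + n) <= free_norm m + free_norm n.
Proof. exact: ler_normD. Qed.

Lemma free_normZ (a : R) m : free_norm (a *: m) = `|a| * free_norm m.
Proof. exact: normrZ. Qed.

Lemma free_norm0_eq0 m : free_norm m = 0 -> m = 0.
Proof. by move=> /normr0_eq0 m0; exact/val_inj. Qed.

HB.instance Definition _ :=
  Lmodule_isNormed.Build R lipschitz_free free_normD free_normZ free_norm0_eq0.

Lemma free_delta_subproof x : evaluation x \in free_pred.
Proof. by rewrite inE; apply/subset_closure/lin_span_sub; exists x. Qed.

Definition free_delta (x : M) : lipschitz_free :=
  MkFree (free_delta_subproof x).

Definition is_free_lift (f : M -> M) (T : lipschitz_free -> lipschitz_free)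
    : Prop :=
  [/\ linear T, continuous T &
      forall x : M, T (free_delta x) = free_delta (f x)].

(** [T_f]: such an operator exists and is unique for [f] in [Lip_0(M, M)]
    ([free_liftP] and [is_free_lift_unique]); a junk value otherwise. *)
Definition free_lift (f : M -> M) : lipschitz_free -> lipschitz_free :=
  get (is_free_lift f).

Lemma lin_span_map (V W : normedModType R) (T : V -> W) (A : set V) (v : V) :
  linear T -> lin_span A v -> lin_span (T @` A) (T v).
Proof.
move=> Tl [n [a [x [Ax ->]]]]; exists n, a, (T \o x).
pose p : {linear V -> W} := HB.pack T (GRing.isLinear.Build _ _ _ _ _ Tl).
split=> [i|]; first by exists (x i).
by rewrite -[T]/(p : V -> W) linear_sum; apply: eq_bigr => i _; rewrite linearZ.
Qed.

Lemma free_span_dense (m : lipschitz_free) (e : R) : 0 < e ->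
  exists2 w : lipschitz_free, lin_span (range free_delta) w & `|m - w| < e.
Proof.
move=> e0; have := valP m; rewrite inE => /closure_normP/(_ e e0)[w Aw mw].
have Fw : w \in free_pred by rewrite inE; exact: subset_closure.
exists (MkFree Fw); last exact: mw.
case: Aw => n [a [x [Dx wE]]].
have /choice[y yx] : forall i, exists y, evaluation y = x i.
  by move=> i; have [y _ yx] := Dx i; exists y.
exists n, a, (free_delta \o y); split=> [i|]; first by exists (y i).
apply: val_inj; rewrite /= wE (@big_morph _ _ free_val 0 +%R)//.
by apply: eq_bigr => i _; rewrite -yx.
Qed.

Lemma is_free_lift_unique f T1 T2 :
  is_free_lift f T1 -> is_free_lift f T2 -> T1 = T2.
Proof.
move=> [T1l T1c T1f] [T2l T2c T2f]; apply/funext => m.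
pose p1 : {linear lipschitz_free -> lipschitz_free} :=
  HB.pack T1 (GRing.isLinear.Build _ _ _ _ _ T1l).
pose p2 : {linear lipschitz_free -> lipschitz_free} :=
  HB.pack T2 (GRing.isLinear.Build _ _ _ _ _ T2l).
pose d : {linear lipschitz_free -> lipschitz_free} := p1 \- p2.
have dc : continuous d by move=> v; exact: cvgB (T1c v) (T2c v).
have /linear_bounded_continuous/linear_boundedP/pinfty_ex_gt0[r r0 dr] := dc.
apply/eqP; rewrite -subr_eq0 -normr_le0; apply/ler_addgt0Pl => e e0.
rewrite addr0.
have [w [n [a [x [Dx wE]]]] mw] := free_span_dense m (divr_gt0 e0 r0).
have dw : d w = 0.
  rewrite wE linear_sum big1// => i _; rewrite linearZ/=.
  by have [y _ <-] := Dx i; rewrite T1f T2f subrr scaler0.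
have -> : T1 m - T2 m = d (m - w) by rewrite linearB dw subr0.
apply: le_trans (dr _) _.
by rewrite mulrC -ler_pdivlMr// ltW.
Qed.

Section Existence.
Variable f : M -> M.
Hypotheses (f_lip : lipschitz_map f) (fo : f o = o).

Lemma comp_lip0 (g : Lip0 o) : (g \o f : M -> R^o) \in lip0_pred o.
Proof.
have [K K0 fK] := lipschitz_map_gt0 f_lip.
have [L L0 gL] := lipschitz_map_gt0 (lip0_lipschitz g).
rewrite inE; split; last by rewrite /= fo lip0_base.
exists (L * K) => x y; apply: le_trans (gL _ _) _.
by rewrite -mulrA ler_wpM2l ?fK// ltW.
Qed.

Definition comp_op (g : Lip0 o) : Lip0 o := MkLip0 (comp_lip0 g).

Lemma comp_op_linear : linear comp_op.
Proof. by move=> a g h; exact/val_inj. Qed.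

Lemma comp_op_bounded :
  exists2 K : R, 0 < K & forall g, `|comp_op g| <= K * `|g|.
Proof.
have [K K0 fK] := lipschitz_map_gt0 f_lip; exists K => // g.
apply: lip_norm_le => [|x y]; first by rewrite mulr_ge0// ltW.
apply: le_trans (le_lip_norm g (f x) (f y)) _.
by rewrite (mulrC K) -mulrA ler_wpM2l ?lip_norm_ge0.
Qed.

Lemma lip_adjoint_subproof (phi : dual_space (Lip0 o)) :
  (phi \o comp_op : Lip0 o -> R^o) \in dual_pred (Lip0 o).
Proof.
have [K K0 fK] := comp_op_bounded.
apply: (@linear_bounded_in_dual _ _ _ (dual_norm phi * K)) => [a g h|g].
  by rewrite /= comp_op_linear dual_linear.
rewrite /= (le_trans (le_dual_norm phi (comp_op g)))// -mulrA ler_wpM2l//.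
exact: dual_norm_ge0.
Qed.

Definition lip_adjoint (phi : dual_space (Lip0 o)) : dual_space (Lip0 o) :=
  MkDual (lip_adjoint_subproof phi).

Lemma lip_adjoint_linear : linear lip_adjoint.
Proof. by move=> a g h; exact/val_inj. Qed.

Lemma lip_adjoint_bounded :
  exists2 K : R, 0 < K & forall phi, `|lip_adjoint phi| <= K * `|phi|.
Proof.
have [K K0 fK] := comp_op_bounded; exists K => // phi.
apply: dual_norm_le => [|g]; first by rewrite mulr_ge0// ltW.
apply: le_trans (le_dual_norm phi (comp_op g)) _; rewrite (mulrC K) -mulrA.
by apply: ler_wpM2l; [exact: dual_norm_ge0|exact: fK].
Qed.

Lemma lip_adjoint_evaluation x : lip_adjoint (evaluation x) = evaluation (f x).
Proof. exact/val_inj. Qed.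

Lemma lip_adjoint_free (m : lipschitz_free) : lip_adjoint m \in free_pred.
Proof.
have [K K0 fK] := lip_adjoint_bounded.
rewrite inE; apply/closure_normP => e e0.
have := valP m; rewrite inE => /closure_normP/(_ _ (divr_gt0 e0 K0))[w Aw mw].
exists (lip_adjoint w).
  have [n [a [x [Dx ->]]]] := lin_span_map lip_adjoint_linear Aw.
  exists n, a, x; split=> // i; have [_ [y _ <-] <-] := Dx i.
  by exists (f y); rewrite // lip_adjoint_evaluation.
have -> : lip_adjoint m - lip_adjoint w = lip_adjoint (free_val m - w).
  exact/val_inj.
by rewrite (le_lt_trans (fK _))// mulrC -ltr_pdivlMr.
Qed.

Lemma is_free_lift_adjoint :
  is_free_lift f (fun m => MkFree (lip_adjoint_free m)).
Proof.
have Tl : linear (fun m : lipschitz_free => MkFree (lip_adjoint_free m)).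
  by move=> a m n; exact/val_inj/val_inj.
split=> //; last by move=> x; exact/val_inj/val_inj.
pose p : {linear lipschitz_free -> lipschitz_free} :=
  HB.pack (fun m => MkFree (lip_adjoint_free m))
  (GRing.isLinear.Build _ _ _ _ _ Tl).
apply: (@bounded_linear_continuous _ _ _ p); apply/linear_boundedP.
have [K K0 fK] := lip_adjoint_bounded.
exists K; split=> [|r Kr m]; first exact: num_real.
by rewrite (le_trans (fK m))// ler_wpM2r// ltW.
Qed.

End Existence.

Lemma free_liftP f :
  lipschitz_map f -> f o = o -> is_free_lift f (free_lift f).
Proof.
by move=> fl fo; apply: getPex; eexists; exact: is_free_lift_adjoint fl fo.
Qed.

End FreeSpace.

(* Main.v *)
Require Import Defs.
From HB Require Import structures.
From mathcomp Require Import all_boot all_order all_algebra.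
From mathcomp Require Import all_classical all_reals all_analysis.
From mathcomp Require Import lra.

(**
The operator [T_f] acts on [m] in the free space by [T_f m g = m (g \o f)].

(3) => (2): if [n] is given by the targeting property for a finite set
containing [x] and [y], then [delta_u - delta_u0] is close to [delta_x] and sent
near [0] by [T_f^n], while [delta_v - delta_v0] is close to [0] and sent near
[delta_y]. As [n] is uniform over the finite set, this extends by linearity to
finitely many vectors in the span of the evaluations, and sums of such
approximants give transitivity of [T_f * T_f].

(2) => (1): the free space is complete, and separable since [M] is countable, so
Birkhoff's transitivity theorem applies.

(1) => (3): let [B] be a small ball around [o] that avoids the nonzero points
[l] of the given finite set. Points outside [B] are uniformly isolated, so
indicators of sets disjoint from [B] are Lipschitz, with a common bound. Let
[m] be the sum of the [delta_x] for [x] in [l], and take [u] in the dense orbit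
close to [m] such that [T_f^n u] is close to [N m], with [N] much larger than
the size of [l]. If the fibre [S] of [f^n] over some [y] outside [B] misses [B],
then [u] takes at the indicator of [S] a value close both to [N] times the
multiplicity of [y] in [l] and to the number of points of [l] in [S]. Hence [y]
is not in [l], which gives (ii), and [S] does not meet [l], which gives (i).
*)

Set Implicit Arguments.
Unset Strict Implicit.
Unset Printing Implicit Defensive.

Import Order.TTheory GRing.Theory Num.Theory.
Import numFieldNormedType.Exports.

Local Open Scope classical_set_scope.
Local Open Scope ring_scope.

(** * Iterates, transitivity and hypercyclicity *)

Section Dynamics.

Lemma iter_pair (V : Type) (T : V -> V) n (p : V * V) :
  iter n (fun p => (T p.1, T p.2)) p = (iter n T p.1, iter n T p.2).
Proof. by elim: n p => [|n IHn] [u v] //=; rewrite IHn. Qed.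

Lemma iter_continuous (V : topologicalType) (T : V -> V) n :
  continuous T -> continuous (iter n T).
Proof.
move=> Tc; elim: n => [|n IHn] v; first by apply: cvg_id.
by apply: (@continuous_comp _ _ _ (iter n T) T); [exact: IHn|exact: Tc].
Qed.

Lemma weakly_mixing_transitive (V : topologicalType) (T : V -> V) :
  weakly_mixing T -> topologically_transitive T.
Proof.
move=> wmT U W Uo [u Uu] Wo [w Ww].
have fst_open A : open A -> open (@fst V V @^-1` A).
  by move=> Ao; apply: open_comp => // x _; exact: cvg_fst.
have [||||n [_ [[p Up <-]]]] := wmT (fst @^-1` U) (fst @^-1` W).
- exact: fst_open.
- by exists (u, u).
- exact: fst_open.
- by exists (w, w).
by rewrite iter_pair => Wp; exists n, (iter n T p.1); split=> //; exists p.1.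
Qed.

(** The vectors whose orbit meets the basic ball [B k] form a set [G k] that is open by continuity
    and dense by transitivity, so Baire's theorem gives a vector in all of them. *)
Lemma transitive_hypercyclic (K : realType) (V : completeNormedModType K)
    (T : V -> V) (s : nat -> V) :
  continuous T -> dense (range s) -> topologically_transitive T ->
  hypercyclic T.
Proof.
move=> Tc sd Tt.
(* Codes that decode to no pair get the whole space, which keeps every [B k] open and nonempty. *)
pose B (k : nat) : set V :=
  if unpickle k is Some (i, j) then ball (s i) j.+1%:R^-1 else setT.
have Bo k : open (B k).
  rewrite /B; case: unpickle => [[i j]|]; last exact: openT.
  exact: ball_open.
have B0 k : B k !=set0.
  rewrite /B; case: unpickle => [[i j]|]; last by exists 0.
  by exists (s i); apply: ballxx; rewrite invr_gt0.
pose G k : set V := \bigcup_n (iter n T @^-1` B k).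
have [] := @Baire K V G _ setT; last 2 first.
- exact: openT.
- move=> x [_ Gx]; exists x => O [y Oy] Oo.
  have /nbhs_ballP[e /= e0 eO] : nbhs y O by exact: open_nbhs_nbhs.
  have [j je] : exists j : nat, j.+1%:R^-1 < e / 2.
    exists (Num.truncn (e / 2)^-1).
    by rewrite invf_plt ?posrE ?divr_gt0// truncnS_gt.
  have [|z [yz [i _ zE]]] := sd _ _ (ball_open y (j.+1%:R^-1 : K)).
    by exists y; apply: ballxx; rewrite invr_gt0.
  rewrite -zE in yz.
  have [n _] := Gx (pickle (i, j)) I.
  rewrite /preimage /B pickleK /= => xz.
  exists (iter n T x); split; last by exists n.
  apply: eO; apply: (@ball_split _ _ (s i)).
    exact: le_ball (ltW je) _ yz.
  exact: le_ball (ltW je) _ xz.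
- move=> k; split.
    apply: bigcup_open => n _; apply: open_comp => // x _.
    exact: iter_continuous.
  move=> O O0 Oo; have [n [_ [[u Ou <-] Bu]]] := Tt _ _ Oo O0 (Bo k) (B0 k).
  by exists u; split=> //; exists n.
- by exists 0.
Qed.

(** * A quantitative hypercyclicity criterion for linear maps *)

Section Criterion.
Context {R : realType} (V : normedModType R) (T : V -> V).

(* The two halves of the hypercyclicity criterion, at a single vector [w] and a
   single time [n]. *)
Definition mixing_at (n : nat) (e : R) (w : V) : Prop :=
  (exists2 s, `|w - s| <= e & `|iter n T s| <= e) /\
  (exists2 t, `|t| <= e & `|w - iter n T t| <= e).

Hypothesis Tlin : linear T.

Lemma iter_linear n : linear (iter n T).
Proof. by elim: n => [|n IHn] a u v //=; rewrite IHn Tlin. Qed.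

Lemma iter0 n : iter n T 0 = 0.
Proof.
by have := iter_linear n (-1) 0 0; rewrite !scaleN1r !addNr.
Qed.

Lemma mixing_at0 n : mixing_at n 0 0.
Proof. by split; exists 0; rewrite ?iter0 ?subr0 normr0. Qed.

Lemma mixing_atD n (a e1 e2 : R) u v : mixing_at n e1 u -> mixing_at n e2 v ->
  mixing_at n (`|a| * e1 + e2) (a *: u + v).
Proof.
have bound (x y : V) (d1 d2 : R) : `|x| <= d1 -> `|y| <= d2 ->
    `|a *: x + y| <= `|a| * d1 + d2.
  move=> xd yd; rewrite (le_trans (ler_normD _ _))// lerD// normrZ.
  by rewrite ler_wpM2l.
have subE (x y z w : V) : a *: x + y - (a *: z + w) = a *: (x - z) + (y - w).
  by rewrite opprD addrACA -scalerBr.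
move=> [[s us sn] [t tn ut]] [[s' us' sn'] [t' tn' ut']]; split.
  by exists (a *: s + s'); rewrite ?iter_linear ?subE bound.
by exists (a *: t + t'); rewrite ?iter_linear ?subE bound.
Qed.

Lemma mixing_at_sum n e m (a : 'I_m -> R) (x : 'I_m -> V) :
  (forall i, mixing_at n e (x i)) ->
  mixing_at n ((\sum_(i < m) `|a i|) * e) (\sum_(i < m) a i *: x i).
Proof.
move=> xe; rewrite mulr_suml.
elim/big_ind2: _ => [|d1 u d2 v ud vd|i _].
- exact: mixing_at0.
- by have := mixing_atD 1 ud vd; rewrite normr1 mul1r scale1r.
- by have := mixing_atD (a i) (xe i) (mixing_at0 n); rewrite !addr0.
Qed.

(** [F] and [C] depend on [w] alone, so the precision [e] can be fixed in terms of [C] before the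
    time [n] is obtained. *)
Lemma mixing_at_lin_span (A : set V) w : lin_span A w ->
  exists (F : set V) (C : R), [/\ finite_set F, F `<=` A, 0 <= C &
    forall n e, (forall x, F x -> mixing_at n e x) -> mixing_at n (C * e) w].
Proof.
move=> [m [a [x [Ax ->]]]]; exists (range x), (\sum_(i < m) `|a i|); split.
- exact: finite_image.
- by move=> _ [i _ <-].
- by rewrite sumr_ge0.
- by move=> n e xe; apply: mixing_at_sum => i; apply: xe; exists i.
Qed.

Lemma mixing_at_le n e e' w : e <= e' -> mixing_at n e w -> mixing_at n e' w.
Proof.
move=> ee' [[s ws sn] [t tn wt]].
by split; [exists s|exists t]; rewrite // (le_trans _ ee').
Qed.

(** If [s] is near [u] and sent near 0, and [t] is near 0 and sent near [w], then [s + t] leads from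
    [u] to [w]. One [n] serves both coordinates, as it is taken for all the vectors of [A]
    involved. *)
Lemma mixing_at_weakly_mixing (A : set V) :
  dense (lin_span A) ->
  (forall (e : R) (F : set V), 0 < e -> finite_set F -> F `<=` A ->
    exists n, forall x, F x -> mixing_at n e x) ->
  weakly_mixing T.
Proof.
move=> Ad Amix.
have approx (O : set (V * V)) : open O -> O !=set0 ->
    exists u v e, [/\ lin_span A u, lin_span A v, 0 < e &
      forall u' v', `|u - u'| < e -> `|v - v'| < e -> O (u', v')].
  move=> Oo [p Op].
  have /nbhs_ballP[e /= e0 eO] : nbhs p O by exact: open_nbhs_nbhs.
  have e20 : 0 < e / 2 by rewrite divr_gt0.
  have [|u [pu Au]] := Ad _ _ (ball_open p.1 (e / 2)).
    by exists p.1; exact: ballxx.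
  have [|v [pv Av]] := Ad _ _ (ball_open p.2 (e / 2)).
    by exists p.2; exact: ballxx.
  exists u, v, (e / 2); split=> // u' v' uu' vv'; apply: eO; split=> /=.
    by apply: (ball_split pu); rewrite -ball_normE.
  by apply: (ball_split pv); rewrite -ball_normE.
move=> U W Uo U0 Wo W0.
have [u1 [u2 [d [Au1 Au2 d0 dU]]]] := approx U Uo U0.
have [w1 [w2 [e [Aw1 Aw2 e0 eW]]]] := approx W Wo W0.
have [F1 [C1 [F1f F1A C10 F1u]]] := mixing_at_lin_span Au1.
have [F2 [C2 [F2f F2A C20 F2u]]] := mixing_at_lin_span Au2.
have [F3 [C3 [F3f F3A C30 F3w]]] := mixing_at_lin_span Aw1.
have [F4 [C4 [F4f F4A C40 F4w]]] := mixing_at_lin_span Aw2.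
pose r := Num.min d e; have r0 : 0 < r by rewrite lt_min d0.
(* With precision [r / 4 / c] each of the four errors is at most [r / 4]; the summand 1 keeps [c]
   positive. *)
pose c := C1 + C2 + C3 + C4 + 1.
have c0 : 0 < c by rewrite ltr_wpDl ?addr_ge0.
have eps0 : 0 < r / 4 / c by rewrite !divr_gt0.
have [||n Fn] := Amix (r / 4 / c) (F1 `|` F2 `|` F3 `|` F4) eps0.
- by rewrite !finite_setU.
- by move=> x [[[]|]|]; [exact: F1A|exact: F2A|exact: F3A|exact: F4A].
have mix C (G : set V) w : C <= c -> G `<=` F1 `|` F2 `|` F3 `|` F4 ->
    (forall n e, (forall x, G x -> mixing_at n e x) ->
      mixing_at n (C * e) w) ->
    mixing_at n (r / 4) w.
  move=> Cc GF Gw; apply: (@mixing_at_le _ (C * (r / 4 / c))).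
    by rewrite mulrCA ger_pMr ?divr_gt0// ler_pdivrMr ?mul1r.
  by apply: Gw => x /GF; exact: Fn.
have Mu1 : mixing_at n (r / 4) u1.
  by apply: mix F1u => [|x ?]; [rewrite /c; lra|do 3 left].
have Mu2 : mixing_at n (r / 4) u2.
  by apply: mix F2u => [|x ?]; [rewrite /c; lra|do 2 left; right].
have Mw1 : mixing_at n (r / 4) w1.
  by apply: mix F3w => [|x ?]; [rewrite /c; lra|left; right].
have Mw2 : mixing_at n (r / 4) w2.
  by apply: mix F4w => [|x ?]; [rewrite /c; lra|right].
have sum_lt (x y : V) : `|x| <= r / 4 -> `|y| <= r / 4 -> `|x - y| < r.
  by move=> xr yr; rewrite (le_lt_trans (ler_normB _ _))//; lra.
have [rd re] : r <= d /\ r <= e by rewrite !ge_min !lexx orbT.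
have iterD x y : iter n T (x + y) = iter n T x + iter n T y.
  by have := iter_linear n 1 x y; rewrite !scale1r.
have addU (u w : V) : mixing_at n (r / 4) u -> mixing_at n (r / 4) w ->
    exists2 z, `|u - z| < r & `|w - iter n T z| < r.
  move=> [[s us sn] _] [_ [t tn wt]]; exists (s + t).
    by rewrite opprD addrA sum_lt.
  by rewrite iterD opprD addrCA addrC sum_lt.
have [z1 uz1 wz1] := addU _ _ Mu1 Mw1.
have [z2 uz2 wz2] := addU _ _ Mu2 Mw2.
exists n, (iter n T z1, iter n T z2); split.
  exists (z1, z2); first by apply: dU; apply: lt_le_trans rd.
  by rewrite iter_pair.
by apply: eW; apply: lt_le_trans re.
Qed.

End Criterion.
End Dynamics.

(** * The free space: norm estimates, completeness, separability *)

Section FreeSpace.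
Context {R : realType} (M : metricType R) (o : M).
Local Notation F := (lipschitz_free o).

Lemma le_free_norm (m : F) (g : Lip0 o) : `|m g| <= `|m| * `|g|.
Proof. exact: le_dual_norm. Qed.

Lemma free_le_norm (m : F) (L : R) : 0 <= L ->
  (forall g : Lip0 o, `|m g| <= L * `|g|) -> `|m| <= L.
Proof. exact: dual_norm_le. Qed.

Lemma freeB (m n : F) (g : Lip0 o) : (m - n) g = m g - n g. Proof. by []. Qed.
Lemma freeZ (a : R) (m : F) (g : Lip0 o) : (a *: m) g = a * m g.
Proof. by []. Qed.

Lemma free_delta_dist x y : `|free_delta o x - free_delta o y| <= mdist x y.
Proof.
apply: free_le_norm => [|g]; first exact: mdist_ge0.
by rewrite mulrC; exact: le_lip_norm.
Qed.

Lemma free_delta_base : free_delta o o = 0.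
Proof. by apply/val_inj/val_inj/funext => g; exact: lip0_base. Qed.

(** A Cauchy filter converges at each [g]. The pointwise limit [phi] is linear, is bounded by
    comparison with one element [m1], and lies in the closed span as a norm limit of free
    elements. *)
Lemma lipschitz_free_complete (G : set_system F) :
  ProperFilter G -> cauchy G -> cvg G.
Proof.
move=> GG /cauchyP Gc.
have pair_ball (m m' : F) e (g : Lip0 o) : ball m e m' ->
    `|m g - m' g| <= e * `|g|.
  rewrite -ball_normE /= => mm'; rewrite -freeB (le_trans (le_free_norm _ _))//.
  by rewrite ler_wpM2r// ltW.
have Gg (g : Lip0 o) : cvg ((fun m : F => m g : R^o) @ G).
  apply/cauchy_cvgP/cauchy_exP => e e0.
  have g0 : 0 < `|g| + 1 by rewrite ltr_wpDl.
  have [m Gm] := Gc _ (divr_gt0 e0 g0).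
  exists (m g); change (G [set m' : F | ball (m g : R^o) e (m' g)]).
  apply: filterS Gm => m' mm'; have {}mm' := pair_ball _ _ _ g mm'.
  rewrite -ball_normE; apply: (le_lt_trans mm').
  by rewrite mulrAC -mulrA gtr_pMr// ltr_pdivrMr// mul1r ltrDl.
pose phi (g : Lip0 o) : R^o := lim ((fun m : F => m g : R^o) @ G).
have phi_ball (m : F) e (g : Lip0 o) : G (ball m e) ->
    `|m g - phi g| <= e * `|g|.
  (* The closed inequality [pair_ball] passes to the limit along [G]. *)
  move=> Gm; have dc : (fun m' : F => `|m g - m' g|) @ G --> `|m g - phi g|.
    by apply: cvg_norm; apply: cvgB; [exact: cvg_cst|exact: Gg].
  apply: (cvgr_to_le dc).
  by apply: filterS Gm => m'; exact: pair_ball.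
have phi_lin : linear phi.
  move=> a g h; apply: cvg_lim => //.
  under eq_fun do rewrite dual_linear.
  by apply: cvgD; [apply: cvgZr; exact: Gg|exact: Gg].
have [m1 Gm1] := Gc 1 ltr01.
have phi_dual : phi \in dual_pred (Lip0 o).
  apply: (@linear_bounded_in_dual _ _ _ (`|m1| + 1)) => // g.
  have -> : phi g = m1 g - (m1 g - phi g) by rewrite subKr.
  rewrite (le_trans (ler_normB _ _))// mulrDl lerD ?phi_ball//.
  exact: le_free_norm.
have phi_near (m : F) e : 0 < e -> G (ball m e) ->
    `|free_val m - MkDual phi_dual| <= e.
  move=> e0 Gm; apply: dual_norm_le => [|g]; first exact: ltW.
  exact: phi_ball.
have phi_free : MkDual phi_dual \in @free_pred R M o.
  rewrite inE; apply/closure_normP => e e0.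
  have e20 : 0 < e / 2 by rewrite divr_gt0.
  have [m Gm] := Gc _ e20.
  have := valP m; rewrite inE => /closure_normP/(_ _ e20)[w Aw mw].
  exists w => //; rewrite -(subrK (free_val m) (MkDual _)) -addrA.
  rewrite (le_lt_trans (ler_normD _ _))// (splitr e) ler_ltD//.
  by rewrite distrC phi_near.
apply/cvg_ex; exists (MkFree phi_free); apply/cvg_ballP => e e0.
have e20 : 0 < e / 2 by rewrite divr_gt0.
have [m Gm] := Gc _ e20; have mphi := phi_near _ _ e20 Gm.
apply: filterS Gm => m' /=; rewrite -!ball_normE /= => mm'.
rewrite -(subrK m (MkFree _)) -addrA.
rewrite (le_lt_trans (ler_normD _ _))// (splitr e) ler_ltD//.
by rewrite distrC.
Qed.

HB.instance Definition _ :=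
  Uniform_isComplete.Build F lipschitz_free_complete.

Lemma dense_free_span : dense (lin_span (range (free_delta o))).
Proof.
move=> O [m Om] Oo.
have /nbhs_ballP[e /= e0 eO] : nbhs m O by exact: open_nbhs_nbhs.
have [w Aw mw] := free_span_dense m e0.
by exists w; split=> //; apply: eO; rewrite -ball_normE.
Qed.

(** Finite combinations of evaluations with rational coefficients are countable in number, and
    rounding the coefficients of an element of the span costs arbitrarily little. *)
Lemma free_separable : countable [set: M] ->
  exists s : nat -> F, dense (range s).
Proof.
move=> /countable_injP[h hinj].
(* [pt] inverts the injection [h], with default value [o] outside its range. *)
pose pt (k : nat) : M := xget o [set x | h x = k].
have ptK x : pt (h x) = x.
  apply: hinj; rewrite ?inE//.
  by apply: (@xgetPex _ o [set y | h y = h x]); exists x.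
pose comb (l : seq (rat * nat)) : F :=
  \sum_(p <- l) ratr p.1 *: free_delta o (pt p.2).
pose s k := if unpickle k is Some l then comb l else 0.
exists s => O [m Om] Oo.
have /nbhs_ballP[e /= e0 eO] : nbhs m O by exact: open_nbhs_nbhs.
have e20 : 0 < e / 2 by rewrite divr_gt0.
have [w [n [a [x [Dx wE]]]] mw] := free_span_dense m e20.
have /choice[y yx] : forall i, exists y, free_delta o y = x i.
  by move=> i; have [y _ yx] := Dx i; exists y.
pose c := \sum_(i < n) `|x i| + 1.
have c0 : 0 < c by rewrite ltr_wpDl ?sumr_ge0.
have /choice[q qa] : forall i, exists q : rat, `|a i - ratr q| < e / 2 / c.
  move=> i; have ec0 := divr_gt0 e20 c0.
  have [q] := @rat_in_itvoo R (a i - e / 2 / c) (a i + e / 2 / c) ltac:(lra).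
  rewrite in_itv/= => /andP[q1 q2]; exists q.
  by rewrite ltr_norml; apply/andP; split; lra.
pose l := [seq (q i, h (y i)) | i <- enum 'I_n].
exists (s (pickle l)); split; last by exists (pickle l).
rewrite /s pickleK; apply: eO; rewrite -ball_normE /=.
rewrite -(subrK w m) -addrA (le_lt_trans (ler_normD _ _))// (splitr e).
rewrite ltr_leD// /comb big_map big_enum/= wE -sumrB.
rewrite (le_trans (ler_norm_sum _ _ _))//.
apply: (@le_trans _ _ (\sum_(i < n) e / 2 / c * `|x i|)).
  apply: ler_sum => i _; rewrite ptK yx -scalerBl normrZ ler_wpM2r//.
  exact/ltW/qa.
rewrite -mulr_sumr mulrAC -mulrA ger_pMr// ler_pdivrMr// mul1r.
by rewrite lerDl.
Qed.

(** * The operator [T_f], with (3) => (2) and (2) => (1) *)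

Section Lift.
Variable f : M -> M.
Hypotheses (f_lip : lipschitz_map f) (fo : f o = o).
Local Notation T := (free_lift f : F -> F).

Lemma free_liftE (m : F) (g : Lip0 o) : T m g = m (comp_op f_lip fo g).
Proof.
by rewrite (is_free_lift_unique (free_liftP f_lip fo)
  (is_free_lift_adjoint f_lip fo)).
Qed.

Lemma iter_free_liftE n (m : F) (g : Lip0 o) :
  iter n T m g = m (iter n (comp_op f_lip fo) g).
Proof.
by elim: n m g => [|n IHn] m g //; rewrite iterS free_liftE IHn -iterSr.
Qed.

Lemma iter_comp_opE n (g : Lip0 o) x :
  iter n (comp_op f_lip fo) g x = g (iter n f x).
Proof. by elim: n x => [|n IHn] x //; rewrite iterS /= IHn -iterSr. Qed.

Lemma iter_free_delta n x :
  iter n T (free_delta o x) = free_delta o (iter n f x).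
Proof. by have [_ _ Td] := free_liftP f_lip fo; elim: n => [|n /= ->]. Qed.

Lemma targeting_mixing_at (e : R) (D : set F) :
  targeting_property o f -> 0 < e -> finite_set D ->
  D `<=` range (free_delta o) ->
  exists n, forall m, D m -> mixing_at T n e m.
Proof.
have [Tl _ _] := free_liftP f_lip fo.
move=> f_targ e0 Df Dd.
have /choice[p pE] : forall m, exists x, D m -> free_delta o x = m.
  move=> m; have [/Dd[x _ <-]|Dm] := pselect (D m); first by exists x.
  by exists o.
have e20 : 0 < e / 2 by rewrite divr_gt0.
have [n _ fn] := f_targ (e / 2) (p @` D) e20 (finite_image _ Df).
exists n => m Dm; have pD : (p @` D) (p m) by exists m.
have [[u [u0]] + [v [v0]]] := fn _ _ pD pD.
rewrite !gt_max => /and3P[ux uo fu] /and3P[vv fv fo'].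
have iterB a b : iter n T (a - b) = iter n T a - iter n T b.
  by rewrite addrC -scaleN1r (iter_linear Tl) scaleN1r addrC.
(* Used with [c] or [d] standing for the target and for [o], whose evaluation is 0. *)
have delta2 a b c d : mdist a c < e / 2 -> mdist b d < e / 2 ->
    `|free_delta o c - (free_delta o a - free_delta o b) - free_delta o d| <= e.
  move=> ac bd; rewrite opprD opprK !addrA -(addrA (_ - _)).
  rewrite (le_trans (ler_normD _ _))// (splitr e) lerD//.
    by rewrite distrC (le_trans (free_delta_dist _ _))// ltW.
  by rewrite (le_trans (free_delta_dist _ _))// ltW.
rewrite -(pE m Dm); split.
  exists (free_delta o u - free_delta o u0).
    by have := delta2 _ _ _ _ ux uo; rewrite free_delta_base subr0.
  rewrite iterB !iter_free_delta (le_trans (free_delta_dist _ _))//.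
  by rewrite ltW// (lt_trans fu)//; lra.
exists (free_delta o v - free_delta o v0).
  by rewrite (le_trans (free_delta_dist _ _))// ltW// (lt_trans vv)//; lra.
rewrite iterB !iter_free_delta.
by have := delta2 _ _ _ _ fv fo'; rewrite free_delta_base subr0.
Qed.

Lemma targeting_weakly_mixing : targeting_property o f -> weakly_mixing T.
Proof.
move=> f_targ; have [Tl _ _] := free_liftP f_lip fo.
apply: (mixing_at_weakly_mixing Tl dense_free_span) => e D e0 Df Dd.
exact: targeting_mixing_at.
Qed.

Lemma weakly_mixing_hypercyclic : countable [set: M] ->
  weakly_mixing T -> hypercyclic T.
Proof.
move=> /free_separable[s sd] Tmix; have [_ Tc _] := free_liftP f_lip fo.
exact: (transitive_hypercyclic Tc sd (weakly_mixing_transitive Tmix)).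
Qed.

End Lift.
End FreeSpace.

(** The orbit comes near [m] at time [k] and near [N *: m] at time [j]. Taking [N] large makes the
    vector at time [j] longer than all those up to time [k], which forces [k < j]. *)
Lemma hypercyclic_return (R : realType) (V : normedModType R) (T : V -> V)
    (m : V) (d C : R) : hypercyclic T -> m != 0 -> 0 < d ->
  exists u n N,
    [/\ (0 < n)%N, `|m - u| < d, C <= N & `|N *: m - iter n T u| < d].
Proof.
move=> [x xd] m0 d0.
have near_orbit v : exists n, `|v - iter n T x| < d.
  have [|w [vw [n _ wE]]] := xd _ _ (ball_open v d).
    by exists v; exact: ballxx.
  by exists n; move: vw; rewrite -wE -ball_normE.
have [k mk] := near_orbit m.
pose c := \sum_(i < k.+1) `|iter i T x|.
have c0 : 0 <= c by rewrite sumr_ge0.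
pose N := `|C| + (c + d) / `|m|.
have [j Nj] := near_orbit (N *: m).
have cj : c < `|iter j T x|.
  have Nm : c + d <= `|N *: m|.
    rewrite normrZ -ler_pdivrMr ?normr_gt0// (le_trans _ (ler_norm N))//.
    by rewrite /N lerDr.
  have := ler_normD (N *: m - iter j T x) (iter j T x); rewrite subrK; lra.
have kj : (k < j)%N.
  rewrite ltnNge; apply/negP => jk; move: cj; apply/negP; rewrite -leNgt.
  rewrite /c (bigD1 (Ordinal (jk : (j < k.+1)%N)))//= lerDl.
  by rewrite sumr_ge0.
exists (iter k T x), (j - k)%N, N; split=> //.
- by rewrite subn_gt0.
- by rewrite (le_trans (ler_norm C))// lerDl divr_ge0// addr_ge0// ltW.
- by rewrite -iterD subnK// ltnW.
Qed.

(** * Indicator functions and (1) => (3) *)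

Section Targeting.
Context {R : realType} (M : metricType R) (o : M).
Local Notation F := (lipschitz_free o).

(* Points at distance at least [e] from [o] are [r]-isolated in [M], so every
   set of such points has a Lipschitz indicator function. *)
Lemma indicator_lip0 (e r : R) (S : set M) : 0 < e -> 0 < r ->
  (forall x y : M, x != y -> mdist x y < r -> ball o e x /\ ball o e y) ->
  (forall x, S x -> ~ ball o e x) ->
  exists2 g : Lip0 o, (forall x, g x = (x \in S)%:R) & `|g| <= r^-1.
Proof.
move=> e0 r0 sep Sb.
pose g (x : M) : R^o := (x \in S)%:R.
have gr x y : `|g x - g y| <= r^-1 * mdist x y.
  rewrite /g mulrC ler_pdivlMr//.
  have [->|xy] := eqVneq x y; first by rewrite subrr normr0 mul0r mdist_ge0.
  have Sr : x \in S \/ y \in S -> r <= mdist x y.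
    move=> Sxy; rewrite leNgt; apply/negP => /(sep _ _ xy)[bx by_].
    by case: Sxy => /set_mem/Sb.
  case: (boolP (x \in S)) Sr => xS; case: (boolP (y \in S)) => yS Sr;
    rewrite ?subrr ?subr0 ?sub0r ?normrN ?normr0 ?normr1 ?mul0r ?mul1r
      ?mdist_ge0//; apply: Sr; by [left|right].
have gl : g \in lip0_pred o.
  rewrite inE; split.
    by exists r^-1 => x y; apply: le_trans (gr x y); rewrite /mdist/= distrC.
  rewrite /g memNset// => /Sb; apply; exact: ballxx.
exists (MkLip0 gl) => //; apply: lip_norm_le => //.
by rewrite invr_ge0 ltW.
Qed.

(** Meant for indicators: two such errors add up to [1 / 2], less than the unit gap in the counts
    compared later. *)
Lemma free_close_pairing (m m' : F) (g : Lip0 o) (r : R) : 0 < r ->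
  `|g| <= r^-1 -> `|m - m'| < r / 4 -> `|m g - m' g| <= 1 / 4.
Proof.
move=> r0 gr mm'; rewrite -freeB (le_trans (le_free_norm _ _))//.
apply: (@le_trans _ _ (r / 4 * r^-1)); first by rewrite ler_pM// ltW.
by rewrite mulrAC divff ?gt_eqF.
Qed.

Lemma min_dist_gt0 (l : seq M) (e : R) : 0 < e -> o \notin l ->
  exists e', [/\ 0 < e', e' <= e & forall x, x \in l -> ~ ball o e' x].
Proof.
move=> e0; elim: l => [|x l IHl]; first by exists e.
rewrite inE negb_or => /andP[ox /IHl[e' [e'0 e'e el]]].
exists (Num.min e' (mdist o x)); split.
- by rewrite lt_min e'0 mdist_gt0.
- by rewrite ge_min e'e.
- move=> y; rewrite inE ballEmdist /= => /orP[/eqP ->|/el ly].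
    by rewrite lt_min ltxx andbF.
  by rewrite lt_min => /andP[+ _]; move: ly; rewrite ballEmdist.
Qed.

Variable f : M -> M.
Hypotheses (f_lip : lipschitz_map f) (fo : f o = o).
Local Notation T := (free_lift f : F -> F).

Lemma iter_fixpoint n : iter n f o = o.
Proof. by elim: n => //= n ->. Qed.

Lemma hypercyclic_targeting :
  asymptotically_uniformly_discrete o -> hypercyclic T ->
  targeting_property o f.
Proof.
move=> M_aud Thyp e0 D e0_gt0 /finite_seqP[l0 ->].
(* The fixed point [o] is set aside: there [o] itself serves as witness. *)
pose l := [seq x <- l0 | x != o].
have lE x : x \in l0 -> x != o -> x \in l by rewrite mem_filter => -> ->.
have ol : o \notin l by rewrite mem_filter eqxx.
have [e [e_gt0 ee0 lb]] := min_dist_gt0 e0_gt0 ol.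
have [r r0 sep] := M_aud _ e_gt0.
pose m := \sum_(x <- l) free_delta o x.
have mE (g : Lip0 o) : m g = \sum_(x <- l) g x.
  by rewrite /m; elim/big_rec2 : _ => [|x _ v _ <-].
have m_ge1 (g : Lip0 o) (S : set M) z : (forall x, g x = (x \in S)%:R) ->
    z \in l -> S z -> 1 <= m g.
  move=> gS zl Sz; rewrite mE (big_rem z)//= gS mem_set// lerDl.
  by rewrite sumr_ge0// => x _; rewrite gS.
have m_le (g : Lip0 o) (S : set M) : (forall x, g x = (x \in S)%:R) ->
    m g <= (size l)%:R.
  move=> gS; rewrite mE -sum1_size natr_sum ler_sum// => x _.
  by rewrite gS lern1 leq_b1.
(* Witnesses [u = x] and [v0 = o] are imposed, with [u0] and [v] in the ball around [o]; the second
   alternative covers points that [f^n] sends into that ball. *)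
suff [n n0 nl] : exists2 n, (0 < n)%N & forall x, x \in l ->
    (exists u0, ball o e u0 /\
      (iter n f x = iter n f u0 \/ ball o e (iter n f x) /\ u0 = o)) /\
    (exists2 v, ball o e v & iter n f v = x).
  exists n => // x y lx ly; split.
    have [->|xo] := eqVneq x o.
      by exists o, o; rewrite !mdistxx !maxxx.
    have [[u0 [u0e fx]] _] := nl _ (lE _ lx xo).
    exists x, u0; rewrite mdistxx !gt_max e0_gt0 /=; apply/andP; split.
      by move: u0e; rewrite ballEmdist /= metric_sym => /lt_le_trans; apply.
    case: fx => [->|[+ ->]]; first by rewrite mdistxx.
    by rewrite ballEmdist /= metric_sym iter_fixpoint => /lt_le_trans; apply.
  have [->|yo] := eqVneq y o.
    by exists o, o; rewrite !iter_fixpoint !mdistxx !maxxx.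
  have [_ [v ve fv]] := nl _ (lE _ ly yo).
  exists v, o; rewrite fv iter_fixpoint !mdistxx !gt_max e0_gt0 !andbT.
  by move: ve; rewrite ballEmdist /= metric_sym => /lt_le_trans; apply.
have [l_nil|[z zl]] : l = [::] \/ exists z, z \in l.
    by case: (l) => [|z s]; [left|right; exists z; rewrite mem_head].
  by exists 1%N => // x; rewrite l_nil.
have indic S := @indicator_lip0 e r S e_gt0 r0 sep.
have m_neq0 : m != 0.
  have [|g gS _] := indic [set z]; first by move=> _ ->; exact: lb.
  apply/eqP => m0; have := m_ge1 _ _ _ gS zl erefl.
  by rewrite m0 ler10.
have r40 : 0 < r / 4 by rewrite divr_gt0.
have [u [n [N [n0 mu NC Nu]]]] :=
  hypercyclic_return ((size l)%:R + 1) Thyp m_neq0 r40.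
(* As [h] is [g] composed with [f^n], the value of [T^n u] at [g] is that of [u] at [h]. *)
have indic_pull y : ~ ball o e y ->
    ~ (exists2 v, ball o e v & iter n f v = y) ->
    exists g h : Lip0 o, [/\ (forall x, g x = (x \in [set y])%:R),
      (forall x, h x = (x \in (iter n f @^-1` [set y]))%:R),
      `|N * m g - u h| <= 1 / 4 & `|m h - u h| <= 1 / 4].
  move=> yb fy.
  have [|g gE gr] := indic [set y]; first by move=> _ ->.
  have [|h hE hr] := indic (iter n f @^-1` [set y]).
    by move=> x fx xb; apply: fy; exists x.
  exists g, h; split=> //; last exact: free_close_pairing mu.
  have -> : u h = iter n T u g.
    rewrite (iter_free_liftE f_lip fo); congr (free_val u _).
    apply/val_inj/funext => x /=; rewrite (iter_comp_opE f_lip fo) gE hE.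
    by congr (_%:R); apply/idP/idP; rewrite !inE.
  by rewrite -freeZ; exact: free_close_pairing Nu.
(* Otherwise [N <= N * m g <= u h + 1 / 4 <= m h + 1 / 2 <= size l + 1 / 2], against
   [size l + 1 <= N]. *)
have hit y : y \in l -> exists2 v, ball o e v & iter n f v = y.
  move=> yl; apply: contrapT => fy.
  have [g [h [gE hE Nm uh]]] := indic_pull y (lb _ yl) fy.
  have m1 := m_ge1 _ _ _ gE yl erefl.
  have ml := m_le _ _ hE.
  have NNm : N <= N * m g.
    by rewrite ler_peMr// (le_trans _ NC)// addr_ge0.
  by move: Nm uh; rewrite !ler_norml => /andP[_ +] /andP[+ _]; lra.
exists n => // x xl; split; last exact: hit.
have [fxb|fxb] := pselect (ball o e (iter n f x)).
  by exists o; split; [exact: ballxx|right].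
have [[v vb fv]|fx] :=
    pselect (exists2 v, ball o e v & iter n f v = iter n f x).
  by exists v; split=> //; left.
(* By [hit], the point [f^n x] is not in [l], so [m g = 0] and [u h <= 1 / 4], while [m h >= 1]
   forces [u h >= 3 / 4]. *)
exfalso; have [g [h [gE hE Nm uh]]] := indic_pull _ fxb fx.
have m1 := m_ge1 _ _ _ hE xl erefl.
have mg0 : m g = 0.
  rewrite mE big_seq big1// => y yl; rewrite gE memNset// => yE.
  by apply: fx; rewrite -yE; exact: hit.
by move: Nm uh; rewrite mg0 mulr0 !ler_norml => /andP[+ _] /andP[_ +]; lra.
Qed.

End Targeting.

Theorem theorem4p16 (R : realType) (M : metricType R) (o : M) (f : M -> M)
  (f_lip : lipschitz_map f) (f_o : f o = o)
  (M_countable : countable [set: M])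
  (M_aud : asymptotically_uniformly_discrete o) :
  let T_f : lipschitz_free o -> lipschitz_free o := free_lift f in
  (hypercyclic T_f <-> weakly_mixing T_f) /\
  (weakly_mixing T_f <-> targeting_property o f).
Proof.
have hyp_targ := hypercyclic_targeting f_lip f_o M_aud.
have targ_mix := targeting_weakly_mixing f_lip f_o.
have mix_hyp := weakly_mixing_hypercyclic f_lip f_o M_countable.
split; split=> //.
  exact: (targ_mix \o hyp_targ).
exact: (hyp_targ \o mix_hyp).
Qed.
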